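(* Let $\ell \geq 2$ and $k \geq 1$ be integers and let $G$ be a graph no connected component of which is a clique or an $\ell$-clique. If there exists an edition set $F$ for $G$ with $|F| = k$ such that $G+F$ is an $\mathcal{L}_\ell$-cluster graph, then $|V(G_{\mathrm{Q}})| \leq (2\ell+2)k$, $|\mathcal{P}(G_{\mathrm{Q}})| \leq 2\ell k$ and $|\mathcal{S}(G_{\mathrm{Q}})| \leq 2k$.
   Context: All graphs are finite, simple and undirected. A clique is a complete graph; an $\ell$-clique is a connected complete $\ell$-partite graph. An $\mathcal{L}_\ell$-cluster graph is a graph each of whose connected components is a clique or an $\ell$-clique. An edition set $F$ for $G$ is a set of unordered pairs of distinct vertices of $G$, no pair occurring twice, each marked $-$ (an edge of $G$ to be deleted) or $+$ (a non-edge of $G$ to be added); $G+F$ is the resulting graph. Modular decomposition: a module of $G$ is a set $M \subseteq V(G)$ such that every vertex outside $M$ is adjacent to all or to none of the vertices of $M$. A module is strong if for every module $M'$ either $M \cap M' = \emptyset$ or one of $M, M'$ contains the other. The modular decomposition tree $T_G$ has the strong modules of $G$ as nodes, $V(G)$ as root and the singletons $\{v\}$ as leaves; the children of an internal node $M$ are the maximal strong modules properly contained in $M$. An internal node $M$ is labelled P if $G[M]$ is disconnected, S if the complement of $G[M]$ is disconnected, and N otherwise. Q-partition and Q-quotient graph: the Q-partition $\Pi$ of $V(G)$ is defined by: if $\{x\}$ is a leaf child of a node labelled N, then $\{x\}$ is a part of $\Pi$; if $\{x_1\},\dots,\{x_j\}$ are all the leaf children of a node labelled P or S, then $\{x_1,\dots,x_j\}$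 is a part of $\Pi$. Each part is a module, so between two distinct parts either all or no edges are present. The Q-quotient graph $G_{\mathrm{Q}}$ has the parts of $\Pi$ as vertices, two parts being adjacent iff there are edges of $G$ between them. A vertex of $G_{\mathrm{Q}}$ is a U-vertex if its part is a singleton, a P-vertex if its part (of size at least two) consists of the leaf children of a node labelled P, and an S-vertex if its part (of size at least two) consists of the leaf children of a node labelled S. $\mathcal{P}(G_{\mathrm{Q}})$ and $\mathcal{S}(G_{\mathrm{Q}})$ denote the sets of P-vertices and S-vertices of $G_{\mathrm{Q}}$. *)

(* Defs.v *)
From mathcomp Require Import all_boot.

Set Implicit Arguments.
Unset Strict Implicit.
Unset Printing Implicit Defensive.

Record sgraph := SGraph {
  vert :> finType;
  adj : rel vert;
  adj_sym : symmetric adj;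
  adj_irr : irreflexive adj }.

Section Graphs.
Variable G : sgraph.
Implicit Types A C : {set G}.

Definition induced_adj A : rel {x : G | x \in A} :=
  fun u v => adj (val u) (val v).

Fact induced_sym A : symmetric (@induced_adj A).
Proof. by move=> u v; apply: adj_sym. Qed.

Fact induced_irr A : irreflexive (@induced_adj A).
Proof. by move=> u; apply: adj_irr. Qed.

Definition induced A : sgraph := SGraph (@induced_sym A) (@induced_irr A).

Definition compl_adj : rel G := fun x y => (x != y) && ~~ adj x y.

Fact compl_sym : symmetric compl_adj.
Proof. by move=> x y; rewrite /compl_adj eq_sym adj_sym. Qed.

Fact compl_irr : irreflexive compl_adj.
Proof. by move=> x; rewrite /compl_adj eqxx. Qed.

Definition complement : sgraph := SGraph compl_sym compl_irr.

Definition connected : bool := [forall x : G, forall y : G, connect (@adj G) x y].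

Definition components : {set {set G}} :=
  [set [set y | connect (@adj G) x y] | x : G].

Definition is_clique : Prop := forall x y : G, x != y -> adj x y.

(* [partition] forces the l classes to be nonempty. *)
Definition complete_multipartite (l : nat) : Prop :=
  exists P : {set {set G}},
    [/\ partition P [set: G], #|P| = l
      & forall x y : G, adj x y = (pblock P x != pblock P y)].

Definition is_lclique (l : nat) : Prop :=
  connected /\ complete_multipartite l.

End Graphs.

Definition cluster_graph (l : nat) (G : sgraph) : Prop :=
  forall C, C \in components G ->
    is_clique (induced C) \/ is_lclique (induced C) l.

Section Edition.
Variable G : sgraph.

(* A marked pair is (p, b) with p a two-element set of vertices; b = true is
   the mark + (addition) and b = false is the mark - (deletion). *)
Definition edition_set (F : {set {set G} * bool}) : Prop :=
  [/\ forall p, p \in F -> #|p.1| = 2,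
      {in F &, injective fst},
      forall x y : G, ([set x; y], false) \in F -> adj x y
    & forall x y : G, ([set x; y], true) \in F -> ~~ adj x y].

Variable F : {set {set G} * bool}.

Definition edit_adj : rel G := fun x y =>
  (x != y) && ((([set x; y], true) \in F)
               || adj x y && (([set x; y], false) \notin F)).

Fact edit_sym : symmetric edit_adj.
Proof. by move=> x y; rewrite /edit_adj eq_sym adj_sym setUC. Qed.

Fact edit_irr : irreflexive edit_adj.
Proof. by move=> x; rewrite /edit_adj eqxx. Qed.

Definition edit : sgraph := SGraph edit_sym edit_irr.

End Edition.

Section ModularDecomposition.
Variable G : sgraph.
Implicit Types M N : {set G}.

Definition is_module M : bool :=
  [forall z : G, (z \notin M) ==>
     ([forall x in M, adj z x] || [forall x in M, ~~ adj z x])].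

Definition strong_module M : bool :=
  is_module M &&
  [forall M' : {set G}, is_module M' ==>
     [|| M :&: M' == set0, M \subset M' | M' \subset M]].

(* The empty set satisfies [strong_module] but is not a node of the tree. *)
Definition md_node M : bool := (M != set0) && strong_module M.

Definition md_internal M : bool := md_node M && (1 < #|M|).

Definition md_child N M : bool :=
  [&& md_node N, N \proper M
    & [forall N' : {set G}, (md_node N' && (N' \proper M)) ==>
         ~~ (N \proper N')]].

Definition P_node M : bool := md_internal M && ~~ connected (induced M).

Definition S_node M : bool :=
  md_internal M && ~~ connected (complement (induced M)).

Definition N_node M : bool := [&& md_internal M, ~~ P_node M & ~~ S_node M].

Definition leaf_children M : {set G} := [set x | md_child [set x] M].

Definition Qpartition : {set {set G}} :=
  [set A : {set G} |
     [exists M, N_node M && [exists x in leaf_children M, A == [set x]]]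
  || [exists M, [&& P_node M || S_node M, leaf_children M != set0
                  & A == leaf_children M]]].

Definition Q_adj : rel {A : {set G} | A \in Qpartition} := fun A B =>
  (A != B) && [exists x in val A, exists y in val B, adj x y].

Fact Q_sym : symmetric Q_adj.
Proof.
suff H A B : Q_adj A B -> Q_adj B A by move=> A B; apply/idP/idP; apply: H.
case/andP=> nAB /exists_inP[x xA /exists_inP[y yB exy]].
rewrite /Q_adj eq_sym nAB; apply/exists_inP; exists y => //.
by apply/exists_inP; exists x => //; rewrite adj_sym.
Qed.

Fact Q_irr : irreflexive Q_adj.
Proof. by move=> A; rewrite /Q_adj eqxx. Qed.

Definition Q_quotient : sgraph := SGraph Q_sym Q_irr.

Definition P_vertices : {set Q_quotient} :=
  [set A : Q_quotient | (1 < #|val A|) &&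
     [exists M, P_node M && (val A == leaf_children M)]].

Definition S_vertices : {set Q_quotient} :=
  [set A : Q_quotient | (1 < #|val A|) &&
     [exists M, S_node M && (val A == leaf_children M)]].

End ModularDecomposition.

(* Main.v *)
Require Import Defs.
From mathcomp Require Import all_boot.

(** Two vertices are twins when no third vertex distinguishes them.  Any two
    vertices of a part of the Q-partition are twins (adjacent ones in the leaf
    children of an S-node) and, conversely, twins never lie in distinct parts.
    The bounds are therefore bounds on families of twin classes.  Let [U] be the
    set of at most [2 * k] vertices touched by [F].  Every component of [G + F]
    meets [U], since otherwise it would be a component of [G]; and untouched
    vertices of the same component with the same colour (the class in an
    l-clique, a single colour in a clique) are twins in [G].  Hence the parts
    with an untouched vertex inject into [U x l], and the others into [U]. *)

Set Implicit Arguments.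
Unset Strict Implicit.
Unset Printing Implicit Defensive.

(** * Counting by an injective relation *)

Lemma leq_card_rel (T1 T2 : finType) (D : {set T1}) (E : {set T2})
    (R : T1 -> T2 -> Prop) :
  (forall i, i \in D -> exists2 e, e \in E & R i e) ->
  (forall i j e, i \in D -> j \in D -> R i e -> R j e -> i = j) ->
  #|D| <= #|E|.
Proof.
move=> total inj.
(* Finite choice turns [R] into a function; [None] is the value outside [D], since [T2] may be
   empty. *)
have [f fP] : exists f : T1 -> option T2,
    forall i, i \in D -> exists2 e, f i = Some e & e \in E /\ R i e.
  apply: (fin_all_exists (P := fun i o =>
    i \in D -> exists2 e, o = Some e & e \in E /\ R i e)) => i.
  case: (boolP (i \in D)) => [iD | _]; last by exists None.
  by have [e eE Re] := total i iD; exists (Some e) => _; exists e.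
have fI : {in D &, injective f}.
  move=> i j iD jD fij.
  have [e fi [_ Ri]] := fP i iD; have [e' fj [_ Rj]] := fP j jD.
  by move: fij Rj; rewrite fi fj => -[<-]; apply: inj Ri.
rewrite -(card_in_imset fI) -(card_imset E Some_inj).
apply/subset_leq_card/subsetP => _ /imsetP[i iD ->].
by have [e -> [eE _]] := fP i iD; apply: imset_f.
Qed.

Lemma card_gt1_other (T : finType) (A : {set T}) x :
  1 < #|A| -> exists2 y, y \in A & y != x.
Proof.
case/card_gt1P=> y [z [yA zA yz]].
by case: (eqVneq y x) yz => [-> | yx _]; [exists z; rewrite 1?eq_sym | exists y].
Qed.

(** * Twins, modules and nodes of the modular decomposition tree *)

Section Modules.
Variable G : sgraph.
Implicit Types (x y z : G) (A C M W : {set G}).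

Definition twins x y : Prop :=
  forall z, z != x -> z != y -> adj z x = adj z y.

Lemma twins_sym x y : twins x y -> twins y x.
Proof. by move=> t z zy zx; rewrite t. Qed.

Lemma moduleP M :
  reflect (forall z x y, z \notin M -> x \in M -> y \in M -> adj z x = adj z y)
          (is_module M).
Proof.
apply: (iffP forallP) => [modM z x y zM xM yM | modM z].
  have /implyP/(_ zM)/orP[] := modM z => /forall_inP h; first by rewrite !h.
  by rewrite (negbTE (h x xM)) (negbTE (h y yM)).
apply/implyP => zM; case: (set_0Vmem M) => [-> | [x xM]].
  by apply/orP; left; apply/forall_inP => y; rewrite inE.
case: (boolP (adj z x)) => zx; apply/orP; [left | right];
  by apply/forall_inP => y yM; rewrite (modM z y x zM yM xM).
Qed.

Lemma module_twins x y : twins x y -> is_module [set x; y].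
Proof.
move=> t; apply/moduleP => z u v; rewrite !inE negb_or => /andP[zx zy].
by case/orP=> /eqP-> /orP[]/eqP->; rewrite ?(t z zx zy).
Qed.

Lemma module_setU A C :
  is_module A -> is_module C -> A :&: C != set0 -> is_module (A :|: C).
Proof.
move=> /moduleP mA /moduleP mC /set0Pn[w]; rewrite inE => /andP[wA wC].
apply/moduleP => z.
have mw x : z \notin A :|: C -> x \in A :|: C -> adj z x = adj z w.
  rewrite !inE negb_or => /andP[zA zC] /orP[] xM; first exact: mA.
  exact: mC.
by move=> x y zM xM yM; rewrite !mw.
Qed.

Lemma strongP M :
  reflect (is_module M /\ forall W, is_module W ->
             [\/ M :&: W = set0, M \subset W | W \subset M])
          (strong_module M).
Proof.
apply: (iffP andP) => -[mM sM]; split=> //.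
  move=> W mW; have /forallP/(_ W)/implyP/(_ mW)/or3P[/eqP||] := sM;
    by [constructor 1 | constructor 2 | constructor 3].
apply/forallP => W; apply/implyP => mW; apply/or3P.
case: (sM W mW) => [/eqP||] h; by [constructor 1 | constructor 2 | constructor 3].
Qed.

Lemma md_node_set1 x : md_node [set x].
Proof.
rewrite /md_node -cards_eq0 cards1; apply/strongP; split.
  by apply/moduleP => z u v _ /set1P-> /set1P->.
move=> W _; case: (boolP (x \in W)) => xW.
  by constructor 2; rewrite sub1set.
constructor 1; apply/setP => z; rewrite !inE.
by case: eqP => // ->; apply/negbTE.
Qed.

Lemma md_node_comparable M W x :
  md_node M -> is_module W -> x \in M -> x \in W ->
  (M \subset W) || (W \subset M).
Proof.
case/andP=> _ /strongP[_ sM] mW xM xW.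
case: (sM W mW) => [M0 | -> // | ->]; last by rewrite orbT.
by have := in_set0 x; rewrite -M0 inE xM xW.
Qed.

(** The pair [[set x; y]] is a module, hence comparable with [M], and [M] is too large to lie
    properly inside it. *)
Lemma md_node_twins M x y :
  md_node M -> 1 < #|M| -> twins x y -> x \in M -> y \in M.
Proof.
move=> nM M1 txy xM.
case: (eqVneq x y) => [<- // | nxy].
have := md_node_comparable nM (module_twins txy) xM (set21 x y).
case/orP=> [sM | /subsetP/(_ y)->//]; last exact: set22.
have -> : M = [set x; y] by apply/eqP; rewrite eqEcard sM cards2 nxy.
exact: set22.
Qed.

Lemma md_child_max M W x :
  md_child [set x] M -> md_node W -> x \in W -> W \proper M -> W = [set x].
Proof.
case/and3P=> _ _ /forallP/(_ W) h nW xW pW.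
move: h; rewrite nW pW /= properE sub1set xW /= negbK.
by move=> s; apply/eqP; rewrite eqEsubset s sub1set.
Qed.

Lemma md_childW M x : md_child [set x] M -> x \in M /\ 1 < #|M|.
Proof.
case/and3P=> _ p _; split; first by rewrite -sub1set proper_sub.
by rewrite -(cards1 x) proper_card.
Qed.

(** A node strictly between [[set y]] and [M] would also contain [x], and so lie strictly between
    [[set x]] and [M]. *)
Lemma md_child_twins M x y :
  md_node M -> twins x y -> md_child [set x] M -> md_child [set y] M.
Proof.
move=> nM txy chM; have [xM M1] := md_childW chM.
have yM := md_node_twins nM M1 txy xM.
apply/and3P; split; first exact: md_node_set1.
  by rewrite properEcard sub1set yM cards1.
apply/forallP => W; apply/implyP => /andP[nW pW]; apply/negP => yW.
have W1 : 1 < #|W| by rewrite -(cards1 y) proper_card.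
have yiW : y \in W by rewrite -sub1set proper_sub.
have xW := md_node_twins nW W1 (twins_sym txy) yiW.
by move: W1; rewrite (md_child_max chM nW xW pW) cards1.
Qed.

(** Nodes sharing [x] are comparable; if they differed, the smaller would lie strictly between
    [[set x]] and the larger. *)
Lemma md_parent_unique M W x :
  md_node M -> md_node W -> md_child [set x] M -> md_child [set x] W -> M = W.
Proof.
move=> nM nW cM cW; have [xM M1] := md_childW cM; have [xW W1] := md_childW cW.
have mW : is_module W by case/andP: nW => _ /andP[].
apply/eqP; rewrite eqEsubset.
have := md_node_comparable nM mW xM xW.
case: (boolP (M \subset W)) => sMW; case: (boolP (W \subset M)) => sWM //= _.
  have pM : M \proper W by rewrite properE sMW.
  by move: M1; rewrite (md_child_max cW nM xM pM) cards1.
have pW : W \proper M by rewrite properE sWM.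
by move: W1; rewrite (md_child_max cM nW xW pW) cards1.
Qed.

(** * Cuts, and nodes inducing a disconnected graph *)

(** Such an [A] is a union of connected components of the graph induced on [M]; the empty set and
    [M] itself are allowed. *)
Definition cut M A : bool :=
  [&& A \subset M & [forall a in A, forall b in M :\: A, ~~ adj a b]].

Lemma cutP M A :
  reflect (A \subset M /\
           forall a b, a \in A -> b \in M -> b \notin A -> ~~ adj a b)
          (cut M A).
Proof.
apply: (iffP andP) => -[sAM h]; split=> //.
  move=> a b aA bM bA; move/forall_inP: h => /(_ a aA)/forall_inP; apply.
  by rewrite inE bA.
apply/forall_inP => a aA; apply/forall_inP => b; rewrite inE => /andP[bA bM].
exact: h.
Qed.

Lemma cut_setD M A : cut M A -> cut M (M :\: A).
Proof.
move=> /cutP[sAM h]; apply/cutP; split; first exact: subsetDl.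
move=> a b; rewrite !inE => /andP[aA aM] bM; rewrite bM andbT negbK => bA.
by rewrite adj_sym; apply: h.
Qed.

Lemma disconnected_cut M :
  ~~ connected (induced M) -> exists A, [/\ cut M A, A != set0 & A != M].
Proof.
case/forallPn=> u /forallPn[v nuv].
exists [set val w | w in [set w | connect (@adj (induced M)) u w]].
split.
- apply/cutP; split.
    by apply/subsetP => _ /imsetP[w _ ->]; apply: valP.
  move=> a b /imsetP[w]; rewrite inE => uw ->{a} bM; apply: contra => wb.
  have wb' : @adj (induced M) w (Sub b bM) by rewrite /= /induced_adj SubK.
  apply/imsetP; exists (Sub b bM); last by rewrite SubK.
  by rewrite inE; apply: connect_trans uw (connect1 wb').
- by apply/set0Pn; exists (val u); apply: imset_f; rewrite inE.
- apply: contra nuv => /eqP/setP/(_ (val v)).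
  by rewrite (valP v) => /imsetP[w]; rewrite inE => uw /val_inj->.
Qed.

Lemma connected_cut M A :
  connected (induced M) -> cut M A -> A != set0 -> A = M.
Proof.
move=> /forallP conM /cutP[sAM h] /set0Pn[a aA].
have cl : closed (@adj (induced M)) [pred w | val w \in A].
  apply: intro_closed => [|u v]; first exact/sym_connect_sym/adj_sym.
  rewrite /= !inE => uv uA; apply: contraT => vA.
  by have := h _ _ uA (valP v) vA; rewrite -[adj _ _]/(induced_adj u v) uv.
apply/eqP; rewrite eqEsubset sAM; apply/subsetP => b bM.
have /forallP/(_ (Sub b bM)) := conM (Sub a (subsetP sAM _ aA)).
by move/(closed_connect cl); rewrite !inE !SubK aA.
Qed.

(** The component of [x] in the graph induced on [M] is a node properly inside [M]; as [[set x]] is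
    a child of [M], this component is [[set x]]. *)
Lemma disconnected_child_isolated M x :
  md_node M -> ~~ connected (induced M) -> md_child [set x] M ->
  forall y, y \in M -> ~~ adj x y.
Proof.
move=> nM /disconnected_cut[A [cA A0 AM]] chM.
have [xM M1] := md_childW chM.
have [C0 [cC0 xC0 C0M]] : exists C0, [/\ cut M C0, x \in C0 & C0 != M].
  case: (boolP (x \in A)) => xA; first by exists A.
  exists (M :\: A); split; [exact: cut_setD | by rewrite inE xA |].
  apply: contra A0 => /eqP eM; apply/eqP/setP => z; rewrite inE.
  apply/negbTE/negP => zA; have zM : z \in M.
    by case/cutP: cA => /subsetP + _; apply.
  by move: zM; rewrite -eM inE zA.
(* A minimal cut containing [x] serves as the component of [x]. *)
have [|C /minsetP[/andP[/cutP[sCM cC] xC] minC] sC0] :=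
    @minset_exists _ [pred C | cut M C && (x \in C)] C0; first by rewrite /= cC0.
have /andP[M0 /strongP[/moduleP mM sM]] := nM.
have pC : C \proper M.
  apply: sub_proper_trans sC0 _; rewrite properEneq C0M.
  by case/cutP: cC0.
have mC : is_module C.
  apply/moduleP => z u v zC uC vC.
  case: (boolP (z \in M)) => zM; last first.
    by apply: mM => //; apply: (subsetP sCM).
  by rewrite ![adj z _]adj_sym !(negbTE (cC _ _ _ _ _)).
have nC : md_node C.
  apply/andP; split; first by apply/set0Pn; exists x.
  apply/strongP; split=> // W mW.
  case: (boolP (C :&: W == set0)) => [/eqP|]; first by constructor 1.
  case/set0Pn=> b; rewrite inE => /andP[bC bW].
  case: (boolP (C \subset W)) => [|CW]; first by constructor 2.
  case: (boolP (W \subset C)) => [|WC]; first by constructor 3.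
  have sWM : W \subset M.
    have := md_node_comparable nM mW (subsetP sCM _ bC) bW.
    case/orP => // sMW; case/negP: CW; exact: subset_trans sMW.
  (* The vertex [c] has no neighbour in [C], so the module [W] has no edge to [C :\: W]. Hence
     [C :&: W] and [C :\: W] are both cuts, and the one containing [x] contradicts minimality. *)
  have [c cW cnC] := subsetPn WC; have [a aC anW] := subsetPn CW.
  have nadj u v : u \in C -> u \notin W -> v \in W -> ~~ adj u v.
    move=> uC uW vW; rewrite (moduleP W mW u v c uW vW cW).
    by apply: cC => //; apply: (subsetP sWM).
  have [xW | xW] := boolP (x \in W).
    have e : C :&: W = C.
      apply: minC; last exact: subsetIl.
      rewrite /= inE xC xW !andbT; apply/cutP; split.
        exact: subset_trans (subsetIl _ _) sCM.
      move=> u v; rewrite !inE => /andP[uC uW] vM.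
      case: (boolP (v \in C)) => vC /=; last by move=> _; apply: cC.
      by move=> vW; rewrite adj_sym; apply: nadj.
    by move: aC; rewrite -e inE (negbTE anW) andbF.
  have e : C :\: W = C.
    apply: minC; last exact: subsetDl.
    rewrite /= inE xC xW !andbT; apply/cutP; split.
      exact: subset_trans (subsetDl _ _) sCM.
    move=> u v; rewrite !inE => /andP[uW uC] vM.
    case: (boolP (v \in C)) => vC /=; last by move=> _; apply: cC.
    by rewrite andbT negbK => vW; apply: nadj.
  by move: bC; rewrite -e inE bW.
have eC := md_child_max chM nC xC pC.
move=> y yM; case: (eqVneq y x) => [->|yx]; first by rewrite adj_irr.
by apply: cC => //; rewrite eC inE.
Qed.

Lemma disconnected_children_twins M x y :
  md_node M -> ~~ connected (induced M) ->
  md_child [set x] M -> md_child [set y] M -> twins x y.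
Proof.
move=> nM dM cx cy z zx zy.
have [xM _] := md_childW cx; have [yM _] := md_childW cy.
have isol := disconnected_child_isolated nM dM.
case: (boolP (z \in M)) => zM.
  by rewrite ![adj z _]adj_sym (negbTE (isol x cx z zM)) (negbTE (isol y cy z zM)).
by have /andP[_ /strongP[/moduleP mM _]] := nM; apply: mM.
Qed.

End Modules.

(** * Complementation, and the parts of the Q-partition as twin classes *)

Section Complement.
Variable G : sgraph.
Implicit Types (x y : G) (M N : {set G}).

(** Complementing negates adjacency between distinct vertices. The tree is thus unchanged, and
    S-nodes can be handled as P-nodes of the complement. *)
Lemma complement_module M : @is_module (complement G) M = is_module M.
Proof.
have neq (z u : G) : z \notin M -> u \in M -> z != u.
  by move=> zM uM; apply: contraNneq zM => ->.
apply/moduleP/moduleP => mM z x y zM xM yM;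
  have := mM z x y zM xM yM; rewrite /= /compl_adj !neq //=; first exact: negb_inj.
by move=> ->.
Qed.

Lemma complement_strong M : @strong_module (complement G) M = strong_module M.
Proof.
apply/strongP/strongP => -[]; rewrite complement_module => mM sM; split=> // W.
  by move=> mW; apply: sM; rewrite complement_module.
by rewrite complement_module; apply: sM.
Qed.

Lemma complement_node M : @md_node (complement G) M = md_node M.
Proof. by rewrite /md_node complement_strong. Qed.

Lemma complement_child M N : @md_child (complement G) N M = md_child N M.
Proof.
rewrite /md_child complement_node.
congr [&& _, _ & _]; apply: eq_forallb => W.
by rewrite complement_node.
Qed.

Lemma complement_connected M :
  connected (@induced (complement G) M) = connected (complement (induced M)).
Proof.
by apply: eq_forallb => u; apply: eq_forallb => v; apply: eq_connect.
Qed.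

Lemma complement_twins x y : @twins (complement G) x y -> twins x y.
Proof.
move=> t z zx zy; have := t z zx zy; rewrite /= /compl_adj zx zy /=.
exact: negb_inj.
Qed.

(** A maximal module properly inside [M] and containing both twins would be a node strictly between
    [[set x]] and [M]. *)
Lemma N_node_no_twins M x y :
  N_node M -> x != y -> twins x y -> md_child [set x] M -> False.
Proof.
case/and3P=> iM; rewrite /P_node /S_node iM /= !negbK => con cocon nxy txy cM.
have /andP[nM M1] := iM.
have [xM _] := md_childW cM.
have yM := md_node_twins nM M1 txy xM.
(* In a connected and co-connected [M], two intersecting proper submodules
   cannot cover [M]: otherwise one of them against the rest of [M] would be a
   cut of [G] or of its complement. *)
have ncover (W1 W2 : {set G}) : is_module W1 -> is_module W2 ->
    W1 \proper M -> W2 \proper M -> W1 :&: W2 != set0 -> W1 :|: W2 != M.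
  move=> /moduleP m1 /moduleP m2 /properP[s1 [b bM b1]] /properP[s2 [a aM a2]].
  case/set0Pn=> w; rewrite inE => /andP[w1 w2]; apply/eqP => eM.
  have in1 u : u \in M -> u \notin W2 -> u \in W1.
    by rewrite -eM inE => /orP[] // ->.
  have b2 : b \in W2 by move: bM; rewrite -eM inE (negbTE b1).
  (* Vertices of [M] outside [W2] lie in [W1], so the two modules together make adjacency constant
     between [M :\: W2] and [W2]. *)
  have cst u v : u \in M -> u \notin W2 -> v \in W2 -> adj u v = adj a b.
    move=> uM u2 v2; rewrite (m2 u v b) // ![adj _ b]adj_sym.
    by apply: m1 => //; apply: in1.
  have W20 : W2 != set0 by apply/set0Pn; exists w.
  suff e : W2 = M by move: aM; rewrite -e (negbTE a2).
  case: (boolP (adj a b)) => ab; last first.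
    apply: (connected_cut con) W20; apply/cutP; split=> // v u v2 uM u2.
    by rewrite adj_sym cst.
  rewrite -complement_connected in cocon.
  apply: (connected_cut cocon) W20; apply/cutP; split=> // v u v2 uM u2.
  by rewrite /= /compl_adj adj_sym cst // ab andbF.
(* If [M] were just the pair, [G] or its complement would be disconnected on it. *)
have pxy : [set x; y] \proper M.
  rewrite properEneq subUset !sub1set xM yM /= andbT; apply/eqP => eM.
  have pair_cut (H : sgraph) (p q : H) : p != q -> ~~ adj p q ->
      connected (induced [set p; q]) -> False.
    move=> pq npq con_pq.
    have e : [set p] = [set p; q].
      apply: (connected_cut con_pq); last by apply/set0Pn; exists p; rewrite inE.
      apply/cutP; split; first by rewrite sub1set set21.
      by move=> u v /set1P-> /set2P[]-> //; rewrite inE eqxx.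
    by have := set22 p q; rewrite -e inE eq_sym (negbTE pq).
  case: (boolP (adj x y)) => exy.
    rewrite -complement_connected -eM in cocon.
    by apply: (@pair_cut (complement G) x y) cocon; rewrite //= /compl_adj exy andbF.
  by apply: (pair_cut G x y); rewrite ?eM.
have [|W /maxsetP[/andP[mW pW] maxW] sW] :=
    @maxset_exists _ [pred W | is_module W && (W \proper M)] [set x; y].
  by rewrite /= pxy module_twins.
have xW : x \in W by apply: (subsetP sW); apply: set21.
have yW : y \in W by apply: (subsetP sW); apply: set22.
have nW : md_node W.
  apply/andP; split; first by apply/set0Pn; exists x.
  apply/strongP; split=> // W' mW'.
  case: (boolP (W :&: W' == set0)) => [/eqP|W0]; first by constructor 1.
  case: (boolP (W \subset W')) => [|nWW']; first by constructor 2.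
  constructor 3.
  have /set0Pn[b] := W0; rewrite inE => /andP[bW bW'].
  have sWM := proper_sub pW.
  have := md_node_comparable nM mW' (subsetP sWM _ bW) bW'.
  case/orP => [sM | sW'M].
    by case/negP: nWW'; apply: subset_trans sM.
  have pW' : W' \proper M.
    rewrite properEneq sW'M andbT; apply: contra nWW' => /eqP->; exact: sWM.
  (* By [ncover] the union is a module still proper in [M], so maximality of [W] absorbs [W']. *)
  have <- : W :|: W' = W; last exact: subsetUr.
  apply: maxW; last exact: subsetUl.
  rewrite /= module_setU // properEneq ncover //= subUset sWM; exact: sW'M.
have := md_child_max cM nW xW pW => eW.
by move: yW; rewrite eW inE eq_sym (negbTE nxy).
Qed.

(** The node is disconnected in the complement, and a vertex isolated there is adjacent in [G] to
    the rest of [M]. *)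
Lemma S_node_children_twins M x y :
  S_node M -> md_child [set x] M -> md_child [set y] M -> x != y ->
  twins x y /\ adj x y.
Proof.
case/andP=> /andP[nM _]; rewrite -complement_connected => dM.
rewrite -(complement_node M) in nM.
rewrite -!complement_child => cx cy nxy; split.
  exact/complement_twins/(disconnected_children_twins nM dM cx cy).
have [yM _] := md_childW cy.
have := disconnected_child_isolated nM dM cx yM.
by rewrite /= /compl_adj nxy negbK.
Qed.

Lemma P_node_children_twins M x y :
  P_node M -> md_child [set x] M -> md_child [set y] M -> twins x y.
Proof. by case/andP=> /andP[nM _]; apply: disconnected_children_twins. Qed.

Lemma QpartitionP (A : {set G}) x : A \in Qpartition G -> x \in A ->
  exists M, [/\ md_node M, md_child [set x] M &
    (N_node M /\ A = [set x]) \/ ((P_node M || S_node M) /\ A = leaf_children M)].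
Proof.
rewrite inE => /orP[] /existsP[M].
  case/andP=> NM /exists_inP[y yM /eqP->] /set1P->; exists M; split.
  - by case/and3P: NM => /andP[].
  - by rewrite inE in yM.
  by left.
case/and3P=> PSM _ /eqP-> xM; exists M; split; last by right.
  by case/orP: PSM => /andP[/andP[]].
by rewrite inE in xM.
Qed.

(** Twins have the same parent, whose label fixes the form of both parts; distinct twins cannot be
    leaf children of an N-node. *)
Lemma Qpartition_twins_eq (A B : {set G}) x y :
  A \in Qpartition G -> B \in Qpartition G -> x \in A -> y \in B ->
  twins x y -> A = B.
Proof.
move=> QA QB xA yB txy.
have [M [nM cM MA]] := QpartitionP QA xA.
have [N [nN cN NB]] := QpartitionP QB yB.
have cM' := md_child_twins nM txy cM.
have eMN := md_parent_unique nM nN cM' cN; subst N.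
have excl : N_node M -> (P_node M || S_node M) -> False.
  by case/and3P=> _ /negbTE-> /negbTE->.
case: MA NB => -[MM ->] [[NN ->]|[NN ->]] //.
- case: (eqVneq x y) => [-> // | nxy].
  by case: (N_node_no_twins MM nxy txy cM).
- by case: (excl MM NN).
by case: (excl NN MM).
Qed.

Lemma Qpartition_twins (A : {set G}) x y :
  A \in Qpartition G -> x \in A -> y \in A -> twins x y.
Proof.
move=> QA xA; have [M [nM cM [[_ ->] /set1P-> // | [PS ->]]]] := QpartitionP QA xA.
rewrite inE => cy; case/orP: PS => node; first exact: P_node_children_twins cM cy.
case: (eqVneq x y) => [-> // | nxy].
by have [] := S_node_children_twins node cM cy nxy.
Qed.

Lemma Qpartition_nonempty (A : {set G}) : A \in Qpartition G -> exists x, x \in A.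
Proof.
rewrite inE => /orP[] /existsP[M].
  by case/andP=> _ /exists_inP[x _ /eqP->]; exists x; rewrite inE.
by case/and3P=> _ /set0Pn[x xM] /eqP->; exists x.
Qed.

End Complement.

(** * Adjacency and colours inside a component of a cluster graph *)

Section Cluster.
Variables (l : nat) (H : sgraph).
Hypothesis clusterH : cluster_graph l H.
Implicit Types x y z : H.

Notation linked := (connect (@adj H)).

Lemma linked_sym x y : linked x y = linked y x.
Proof. exact/sym_connect_sym/adj_sym. Qed.

Lemma component_in x : [set y | linked x y] \in components H.
Proof. exact: imset_f. Qed.

(** Within a component, non-adjacency means equality if it is a clique and membership in the same
    class if it is an l-clique. *)
Lemma cluster_nonadj_trans x y z :
  linked x y -> linked x z -> ~~ adj x y -> ~~ adj x z -> ~~ adj y z.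
Proof.
move=> xy xz nxy nxz.
have xC : x \in [set y | linked x y] by rewrite inE.
have yC : y \in [set y | linked x y] by rewrite inE.
have zC : z \in [set y | linked x y] by rewrite inE.
case: (clusterH (component_in x)) => [cl | [_ [P [_ _ adjP]]]].
  have eqx u (uC : u \in [set y | linked x y]) : ~~ adj x u -> u = x.
    apply: contraNeq => ux.
    by apply: (cl (Sub x xC) (Sub u uC)); rewrite -val_eqE /= eq_sym.
  by rewrite (eqx y yC nxy) (eqx z zC nxz) adj_irr.
have := adjP (Sub x xC) (Sub z zC); have := adjP (Sub x xC) (Sub y yC).
have := adjP (Sub y yC) (Sub z zC); rewrite /= /induced_adj /=.
rewrite (negbTE nxy) (negbTE nxz) => -> /esym/negbFE/eqP exy /esym/negbFE/eqP exz.
by rewrite -exy exz eqxx.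
Qed.

Lemma component_colour x : 0 < l ->
  exists c : H -> 'I_l, forall y z,
    linked x y -> linked x z -> c y = c z -> twins y z.
Proof.
move=> l0; set C := [set y | linked x y].
have out y z w : linked x y -> linked x z -> w \notin C -> adj w y = adj w z.
  move=> xy xz; rewrite inE => xw.
  have nadj u : linked x u -> adj w u = false.
    move=> xu; apply/negbTE; apply: contra xw => wu.
    by apply: connect_trans xu _; rewrite linked_sym connect1.
  by rewrite !nadj.
case: (clusterH (component_in x)) => [cl | [_ [P [partP cardP adjP]]]].
  exists (fun=> Ordinal l0) => y z xy xz _ w wy wz.
  have [wC | wC] := boolP (w \in C); last exact: out.
  have yC : y \in C by rewrite inE.
  have zC : z \in C by rewrite inE.
  have -> : adj w y by apply: (cl (Sub w wC) (Sub y yC)); rewrite -val_eqE.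
  by apply/esym; apply: (cl (Sub w wC) (Sub z zC)); rewrite -val_eqE.
case: l l0 cardP => // l' _ cardP.
(* The colour is the index of the class in [enum P], which is below [l]; [0] is a default outside
   the component. *)
exists (fun y => inord (if insub y is Some u then index (pblock P u) (enum P) else 0)).
move=> y z xy xz.
have yC : y \in C by rewrite inE.
have zC : z \in C by rewrite inE.
rewrite !insubT => /(congr1 val).
have inP (u : induced C) : pblock P u \in enum P.
  by rewrite mem_enum pblock_mem // (cover_partition partP).
have idx (u : induced C) : index (pblock P u) (enum P) < l'.+1.
  by rewrite -cardP cardE index_mem.
rewrite /= !inordK // => eyz w wy wz.
have [wC | wC] := boolP (w \in C); last exact: out.
have := adjP (Sub w wC) (Sub y yC); have := adjP (Sub w wC) (Sub z zC).
rewrite /= /induced_adj /= => -> ->.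
by rewrite -(nth_index set0 (inP (Sub y yC))) eyz nth_index.
Qed.

Lemma cluster_colour : 0 < l ->
  exists c : H -> 'I_l, forall x y, linked x y -> c x = c y -> twins x y.
Proof.
move=> l0; have [c cP] := fin_all_exists (fun x => component_colour x l0).
(* Reading the colouring chosen at the root makes linked vertices use the same one. *)
exists (fun x => c (root (@adj H) x) x) => x y xy.
have rxy := rootP linked_sym xy.
rewrite -rxy; apply: cP; rewrite linked_sym.
  exact: connect_root.
by rewrite rxy; apply: connect_root.
Qed.

End Cluster.

(** This compares the subgraphs that [G] and [edit F] induce on a component without touched
    vertices. *)
Lemma is_lclique_ext (T : finType) (r1 r2 : rel T) s1 i1 s2 i2 l :
  r1 =2 r2 -> is_lclique (@SGraph T r1 s1 i1) l -> is_lclique (@SGraph T r2 s2 i2) l.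
Proof.
move=> e [con [P [partP cardP adjP]]]; split; last first.
  by exists P; split=> // x y; rewrite /= -e; apply: adjP.
apply/forallP => x; apply/forallP => y.
by move/forallP/(_ x)/forallP/(_ y): con; rewrite (eq_connect e).
Qed.

(** * Effect of the edition set on vertices and components *)

Section Edition.
Variables (G : sgraph) (F : {set {set G} * bool}).
Implicit Types x y z : G.

Definition touched : {set G} := \bigcup_(p in F) p.1.

Lemma card_touched : edition_set F -> #|touched| <= 2 * #|F|.
Proof.
case=> F2 _ _ _; rewrite mulnC -sum_nat_const -(eq_bigr _ F2) /touched.
elim/big_rec2: _ => [|p A m _ IH]; first by rewrite cards0.
by rewrite (leq_trans (leq_card_setU _ _)) // leq_add2l.
Qed.

(** Both ends of an edited pair are touched, so a single untouched end protects the pair. *)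
Lemma untouched_adj x y : x \notin touched -> @adj (edit F) x y = adj x y.
Proof.
move=> xU; have notF b : (([set x; y], b) \in F) = false.
  apply/negbTE; apply: contra xU => pF; apply/bigcupP.
  by exists ([set x; y], b); rewrite //= set21.
rewrite /= /edit_adj !notF /= andbT.
by case: eqP => // ->; rewrite adj_irr.
Qed.

Lemma untouched_twins x y :
  x \notin touched -> y \notin touched -> @twins (edit F) x y -> twins x y.
Proof.
move=> xU yU t z zx zy; rewrite ![adj z _]adj_sym -!untouched_adj //.
by rewrite ![@adj (edit F) _ z]adj_sym t.
Qed.

Notation linked := (connect (@adj (edit F))).

Lemma component_touched l x :
  (forall C : {set G}, C \in components G ->
     ~ is_clique (induced C) /\ ~ is_lclique (induced C) l) ->
  cluster_graph l (edit F) -> exists2 v, v \in touched & linked x v.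
Proof.
move=> hG cl; apply/exists_inP; apply: contraT.
rewrite negb_exists_in => /forall_inP noU.
have noC y : linked x y -> y \notin touched by move=> xy; apply/negP => /noU/negP.
have eC : [set y | connect (@adj G) x y] = [set y | linked x y].
  have closedL : closed (@adj G) [pred y | linked x y].
    apply: intro_closed => [|y z yz]; first exact/sym_connect_sym/adj_sym.
    rewrite !inE => xy; apply: (connect_trans xy); apply: connect1.
    by rewrite untouched_adj ?noC.
  apply/setP => y; rewrite !inE; apply/idP/idP => [/(closed_connect closedL)|].
    by rewrite !inE connect0 => <-.
  (* Induction from the end of the path: the prefix ends at a vertex linked to [x], hence untouched,
     so the last edge is also an edge of [G]. *)
  case/connectP => p; elim/last_ind: p y => [|p z IH] y; first by move=> _ ->.
  rewrite rcons_path last_rcons => /andP[pp lz] ->.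
  have xl : linked x (last x p) by apply/connectP; exists p.
  apply: connect_trans (IH _ pp erefl) (connect1 _).
  by rewrite -untouched_adj ?noC.
have CG : [set y | linked x y] \in components G.
  by rewrite -eC; apply: imset_f.
have e (u v : {y : G | y \in [set y | linked x y]}) :
    @adj (edit F) (val u) (val v) = adj (val u) (val v).
  by apply: untouched_adj; apply: noC; have := valP u; rewrite inE.
have [ncl nlcl] := hG _ CG.
have [clC | lclC] := cl _ (@component_in (edit F) x).
  case: ncl => u v uv; rewrite -[adj u v]/(adj (val u) (val v)) -e.
  exact: clC.
case: nlcl; exact: is_lclique_ext e lclC.
Qed.

End Edition.

(** * The three bounds, for a family of twin classes *)

Section Counting.
Variables (l : nat) (G : sgraph) (F : {set {set G} * bool}).
Hypothesis hl : 2 <= l.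
Hypothesis hG : forall C : {set G}, C \in components G ->
  ~ is_clique (induced C) /\ ~ is_lclique (induced C) l.
Hypothesis clusterF : cluster_graph l (edit F).

(** The family [part] stands for the parts of the Q-partition: nonempty sets of twins, with no twins
    across two members. *)
Variables (I : finType) (part : I -> {set G}).
Hypothesis part_nonempty : forall i, exists x, x \in part i.
Hypothesis part_twins : forall i x y, x \in part i -> y \in part i -> twins x y.
Hypothesis part_sep : forall i j x y,
  x \in part i -> y \in part j -> twins x y -> i = j.

Notation U := (touched F).
Notation linked := (connect (@adj (edit F))).
Implicit Types x y z : G.

Let linkedC : connect_sym (@adj (edit F)) := @linked_sym (edit F).

(** Evaluating a choice of touched vertices at the root makes it constant on components, so [t]
    names each component of [edit F] by one of its touched vertices. *)
Lemma component_anchor : exists t : G -> G,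
  [/\ forall x, t x \in U, forall x, linked x (t x) &
      forall x y, linked x y = (t x == t y)].
Proof.
have [t0 t0P] := fin_all_exists2 (fun x => component_touched x hG clusterF).
move=> t0U; exists (fun x => t0 (root (@adj (edit F)) x)).
have tlinked x : linked x (t0 (root (@adj (edit F)) x)).
  exact: connect_trans (connect_root _ x) (t0U _).
split=> // x y; apply/idP/eqP => [xy | e]; first by rewrite (rootP linkedC xy).
by apply: connect_trans (tlinked x) _; rewrite e linkedC.
Qed.

Lemma untouched_colour : exists c : G -> 'I_l, forall x y,
  x \notin U -> y \notin U -> linked x y -> c x = c y -> twins x y.
Proof.
have [c cP] := cluster_colour clusterF (ltnW hl).
by exists c => x y xU yU xy exy; apply: (untouched_twins xU yU); apply: cP.
Qed.

Lemma card_parts : #|I| <= #|U| * l.+1.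
Proof.
have [t [tU _ linkedE]] := component_anchor; have [c cP] := untouched_colour.
have -> : l.+1 = #|[set: option 'I_l]| by rewrite cardsT card_option card_ord.
rewrite -cardsX -cardsT.
(* [None] marks a touched vertex itself; the [l] other values are colours of untouched vertices in
   the component anchored there. *)
pose slot x : G * option 'I_l :=
  if x \in U then (x, None) else (t x, Some (c x)).
apply: (leq_card_rel (R := fun i e => exists2 x, x \in part i & e = slot x)).
  move=> i _; have [x xi] := part_nonempty i; exists (slot x); last by exists x.
  by rewrite !inE /slot andbT; case: ifP => //= _; apply: tU.
move=> i j e _ _ [x xi ->] [y yj]; rewrite /slot.
case: (boolP (x \in U)) => xU; case: (boolP (y \in U)) => yU //.
  by case=> exy; apply: (part_sep xi yj); rewrite exy.
case=> /eqP; rewrite -linkedE => xy exy.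
by apply: (part_sep xi yj); apply: cP.
Qed.

(* The anchor of a component is the slot of its untouched vertices, one colour
   each; a wholly touched part is sent to another touched vertex of the
   component, with one of two colours.  The only failure would be a component
   whose anchor [v] is its unique touched vertex: then any neighbour of [v] in
   [G + F] is untouched and hence links [v] to its touched twin. *)
Lemma card_large_parts (D : {set I}) :
  (forall i, i \in D -> 1 < #|part i|) -> #|D| <= #|U| * l.
Proof.
move=> D2.
have [t [tU tlinked linkedE]] := component_anchor; have [c cP] := untouched_colour.
have tt x : t (t x) = t x by apply/esym/eqP; rewrite -linkedE.
pose c0 : 'I_l := Ordinal (ltnW hl); pose c1 : 'I_l := Ordinal hl.
rewrite -[l in _ * l]card_ord -cardsT -cardsX.
pose slot x (e : G * 'I_l) := [\/
  [/\ t e.1 = e.1, x \notin U, linked x e.1 & c x = e.2],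
  [/\ t e.1 <> e.1, x = e.1 & e.2 = c0],
  [/\ t e.1 <> e.1, x = t e.1 & e.2 = c1] |
  [/\ t e.1 = e.1, x = e.1 & forall y, linked x y -> y \in U]].
have slotI x y e : slot x e -> slot y e -> twins x y.
  have c01 : c0 <> c1 by case.
  case=> [[te xU xe cx] | [te ex k0] | [te ex k1] | [te ex xC]];
  case=> [[te' yU ye cy] | [te' ey k0'] | [te' ey k1'] | [te' ey yC]] //.
  - apply: cP => //; last by rewrite cx.
    by apply: connect_trans xe _; rewrite linkedC.
  - by case/negP: xU; apply: yC; rewrite ey linkedC.
  - by rewrite ex ey.
  - by case: c01; rewrite -k0.
  - by case: c01; rewrite -k1.
  - by rewrite ex ey.
  - by case/negP: yU; apply: xC; rewrite ex linkedC.
  - by rewrite ex ey.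
apply: (leq_card_rel (R := fun i e => exists2 x, x \in part i & slot x e)); last first.
  by move=> i j e _ _ [x xi sx] [y yj sy]; apply: part_sep xi yj (slotI x y e sx sy).
move=> i iD.
have in_slots (e : G * 'I_l) : e.1 \in U -> e \in setX U [set: 'I_l].
  by move=> eU; rewrite inE eU inE.
case: (boolP [exists x in part i, x \notin U]) => [/exists_inP[x xi xU] | allU].
  exists (t x, c x); first exact/in_slots/tU.
  by exists x => //; constructor 1; rewrite /= tt.
have {}allU y : y \in part i -> y \in U.
  by move=> yi; apply: contraNT allU => yU; apply/exists_inP; exists y.
have [x xi] := part_nonempty i.
case: (eqVneq (t x) x) => [tx | /eqP tx]; last first.
  by exists (x, c0); [apply/in_slots/allU | exists x => //; constructor 2].
case: (boolP [exists u in U, (u != x) && linked x u]).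
  case/exists_inP=> u uU /andP[ux]; rewrite linkedE tx => /eqP xu.
  exists (u, c1); first exact: in_slots.
  by exists x => //; constructor 3; rewrite /= -xu; split=> //; apply/nesym/eqP.
move=> alone.
have {}alone u : u \in U -> linked x u -> u = x.
  move=> uU xu; apply: contraNeq alone => ux.
  by apply/exists_inP; exists u; rewrite ?ux.
exists (x, c0); first exact/in_slots/allU.
exists x => //; constructor 4; split=> // y xy.
case: (eqVneq y x) => [-> | yx]; [exact: allU | exfalso].
have [z xz] : exists z : G, @adj (edit F) x z.
  case/connectP: xy yx => [[|z p]] /= => [_ -> | /andP[xz _] _ _].
    by rewrite eqxx.
  by exists z.
have zx : z <> x by move=> zx; move: xz; rewrite zx adj_irr.
have zU : z \notin U by apply/negP => zU; apply/zx/alone/connect1.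
have [v vi vx] := card_gt1_other x (D2 i iD).
have zv : @adj (edit F) z v.
  have zv : z != v by apply: contraNneq zU => ->; apply: allU.
  rewrite untouched_adj // -(part_twins xi vi _ zv); last exact/eqP.
  by rewrite -(untouched_adj _ zU) adj_sym.
case/eqP: vx; apply: alone; first exact: allU.
exact: connect_trans (connect1 xz) (connect1 zv).
Qed.

(** A part meeting [U] is charged to a touched representative; any other part is charged to a
    touched vertex of its component of [edit F] that represents no part of [D]. *)
Lemma card_true_twin_parts (D : {set I}) :
  (forall i, i \in D -> 1 < #|part i|) ->
  (forall i x y, i \in D -> x \in part i -> y \in part i -> x != y -> adj x y) ->
  #|D| <= #|U|.
Proof.
move=> D2 Dadj.
have [rep repP] : exists rep : I -> G, forall i,
    rep i \in part i /\ forall y, y \in part i -> y \in U -> rep i \in U.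
  apply: (fin_all_exists (P := fun i r =>
    r \in part i /\ forall y, y \in part i -> y \in U -> r \in U)) => i.
  case: (boolP [exists y in part i, y \in U]) => [/exists_inP[y yi yU] | nU].
    by exists y.
  have [x xi] := part_nonempty i; exists x; split=> // y yi yU.
  by case/exists_inP: nU; exists y.
have repI i j : rep i \in part j -> i = j.
  by move=> h; apply: (part_sep (proj1 (repP i)) h).
pose B := [set i | rep i \in U]; pose R := rep @: (D :&: B).
have RU : R \subset U by apply/subsetP => _ /imsetP[i + ->]; rewrite !inE => /andP[].
(* Representatives account for [D :&: B] against [R]; what remains is to fit [D :\: B] into
   [U :\: R]. *)
rewrite -(cardsID B D) -(cardsID R U) (setIidPr RU) card_in_imset ?leq_add2l; last first.
  by move=> i j _ _ e; apply: repI; rewrite e; case: (repP j).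
(* A part without touched vertices dominates its component, so it is the only
   one there; it remains to find a touched vertex which is not a chosen
   representative. *)
have dom i x z : i \in D -> rep i \notin U -> x \in part i -> z != x ->
    adj z x = linked x z.
  move=> iD riU xi zx.
  have untouched y : y \in part i -> y \notin U.
    by move=> yi; apply: contra riU => yU; apply: (proj2 (repP i)) yU.
  have xU := untouched x xi; have [y yi yx] := card_gt1_other x (D2 i iD).
  have yU := untouched y yi.
  rewrite adj_sym -(untouched_adj _ xU); apply/idP/idP; first exact: connect1.
  (* Otherwise [z] is adjacent to neither [x] nor [y] in [edit F], which makes the adjacent pair
     [x], [y] non-adjacent. *)
  move=> xz; apply: contraT => nxz.
  have exy : @adj (edit F) x y by rewrite untouched_adj // (Dadj i) // eq_sym.
  have zy : z != y by apply: contraNneq nxz => ->.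
  have yz : linked z y by apply: connect_trans (connect1 exy); rewrite linkedC.
  have nyz : ~~ @adj (edit F) z y.
    rewrite adj_sym untouched_adj // adj_sym -(part_twins xi yi) //.
    by rewrite adj_sym -(untouched_adj _ xU).
  have := cluster_nonadj_trans clusterF (x := z) (y := x) (z := y).
  by rewrite linkedC adj_sym exy => /(_ xz yz nxz nyz).
apply: (leq_card_rel (R := fun i v => linked (rep i) v)); last first.
  move=> i j v; rewrite !inE => /andP[riU iD] /andP[rjU jD] iv jv.
  apply: (part_sep (proj1 (repP i)) (proj1 (repP j))) => z zi zj.
  have ij : linked (rep i) (rep j) by apply: connect_trans iv _; rewrite linkedC.
  rewrite (dom i) ?(dom j) ?(proj1 (repP _)) //.
  exact: (same_connect linkedC ij).
move=> i; rewrite !inE => /andP[riU iD]; set x := rep i.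
have xi : x \in part i := proj1 (repP i).
apply/exists_inP; apply: contraT; rewrite negb_exists_in => /forall_inP allR.
have {}allR v : v \in U -> linked x v -> v \in R.
  move=> vU xv; apply: contraT => vR.
  by have := allR v; rewrite !inE vR vU xv => /(_ isT).
have xU : x \notin U := riU.
(* Under [allR], [v] represents a part [j]. A second vertex of that part is untouched, as it would
   otherwise be the representative of [j] too, and it is no twin of [x] because [j] differs from
   [i]. *)
have touched_twin v : v \in U -> linked x v -> exists w,
    [/\ w \notin U, linked x w, twins v w, adj v w & ~ twins x w].
  move=> vU xv; have /imsetP[j] := allR v vU xv.
  rewrite !inE => /andP[jD rjU] ev.
  have vj : v \in part j by rewrite ev; case: (repP j).
  have ij : i <> j by move=> e; move: riU; rewrite e rjU.
  have [w wj wv] := card_gt1_other v (D2 j jD).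
  have tvw := part_twins vj wj.
  have xw : x != w by apply/eqP => e; apply/ij/repI; rewrite -/x e.
  have xv' : x != v by apply: contraNneq xU => ->.
  have lw : linked x w.
    rewrite -(dom i) // 1?eq_sym // adj_sym -tvw // adj_sym (dom i) // eq_sym.
    exact: xv'.
  exists w; split=> //; last by move=> t; apply/ij/(part_sep xi wj t).
    apply/negP => wU; have /imsetP[j' _ ew] := allR w wU lw.
    have e : j' = j by apply: repI; rewrite -ew.
    by move: wv; rewrite ew e ev eqxx.
  by apply: (Dadj j) => //; rewrite eq_sym.
have [v vU xv] := component_touched x hG clusterF.
have [y [yU xy tvy vy nxy]] := touched_twin v vU xv.
(* Since [x] dominates its component and [y] is not its twin, [y] misses some vertex there. *)
have [z [xz zy nyz]] : exists z, [/\ linked x z, z != y & ~~ adj y z].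
  case: (boolP [exists z, [&& linked x z, z != y & ~~ adj y z]]).
    by case/existsP=> z /and3P[]; exists z.
  move=> none; case: nxy => z zx zy; rewrite (dom i) //.
  apply/idP/idP => [xz | yz].
    apply: contraNT none => nzy; apply/existsP; exists z.
    by rewrite xz zy adj_sym.
  by apply: connect_trans xy (connect1 _); rewrite untouched_adj // adj_sym.
have lyz : linked y z by apply: connect_trans xz; rewrite linkedC.
have lyv : linked y v by apply: connect_trans xv; rewrite linkedC.
have nHyz : ~~ @adj (edit F) y z by rewrite untouched_adj.
have Hyv : @adj (edit F) y v by rewrite untouched_adj // adj_sym.
(* An untouched [z] would miss both [y] and its twin [v] in [edit F], although [y] and [v] are
   adjacent. *)
have zU : z \in U.
  apply: contraT => zU.
  have zv : z != v by apply: contraNneq nyz => ->; rewrite adj_sym.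
  have nHzv : ~~ @adj (edit F) z v by rewrite untouched_adj // tvy // adj_sym.
  have := cluster_nonadj_trans clusterF (x := z) (y := y) (z := v).
  rewrite Hyv ![@adj (edit F) z y]adj_sym; apply=> //; first by rewrite linkedC.
  by apply: connect_trans lyv; rewrite linkedC.
have [w [wU xw tzw zw _]] := touched_twin z zU xz.
have wy : w != y by apply: contraNneq nyz => <-; rewrite adj_sym.
have lyw : linked y w by apply: connect_trans xw; rewrite linkedC.
(* Otherwise [y] misses both [w] and [z] in [edit F], although these are adjacent. But then the twin
   [z] of [w] is also adjacent to [y], a contradiction. *)
have yw : adj y w.
  rewrite -(untouched_adj _ yU); apply: contraT => nyw.
  have := cluster_nonadj_trans clusterF lyw lyz nyw nHyz.
  by rewrite untouched_adj // adj_sym zw.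
by move: nyz; rewrite tzw ?yw // eq_sym.
Qed.

End Counting.

Theorem theorem7 (l k : nat) (G : sgraph) (hl : 2 <= l) (hk : 1 <= k)
  (hG : forall C : {set G}, C \in components G ->
     ~ is_clique (induced C) /\ ~ is_lclique (induced C) l)
  (hF : exists F : {set {set G} * bool},
     [/\ edition_set F, #|F| = k & cluster_graph l (edit F)]) :
  [/\ #|Q_quotient G| <= (2 * l + 2) * k,
      #|P_vertices G| <= 2 * l * k
    & #|S_vertices G| <= 2 * k].
Proof.
have [F [/card_touched cardU <- clusterF]] := hF.
pose part (A : Q_quotient G) : {set G} := val A.
have part0 A : exists x, x \in part A := Qpartition_nonempty (valP A).
have twinsI A x y : x \in part A -> y \in part A -> twins x y :=
  Qpartition_twins (valP A).
have sep A B x y : x \in part A -> y \in part B -> twins x y -> A = B.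
  by move=> xA yB t; apply/val_inj/(Qpartition_twins_eq (valP A) (valP B) xA yB t).
split.
- apply: leq_trans (card_parts hl hG clusterF part0 sep) _.
  by rewrite -mulnSr mulnAC leq_mul2r cardU orbT.
- apply: leq_trans (card_large_parts hl hG clusterF part0 twinsI sep _) _.
    by move=> A; rewrite inE => /andP[].
  by rewrite mulnAC leq_mul2r cardU orbT.
(* The remaining condition is that distinct leaf children of an S-node are adjacent. *)
apply: leq_trans (card_true_twin_parts hG clusterF part0 twinsI sep _ _) cardU.
  by move=> A; rewrite inE => /andP[].
move=> A x y; rewrite inE => /andP[_ /existsP[M /andP[SM /eqP eA]]].
rewrite /part eA !inE => cx cy nxy.
by have [] := S_node_children_twins SM cx cy nxy.
Qed.
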